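(* Let $G=(U,W,T,S)$ and $G'=(U',W',T',S')$ be two $S_{\mathcal{MC}}$-approximations such that $|U|=|U'|$ and $|W|=|W'|$. Let $(U,\tau)$ and $(U',\tau')$ be the topological spaces given by $\tau=\{\overline{G}(A)\mid A\subseteq W\}$ and $\tau'=\{\overline{G'}(A')\mid A'\subseteq W'\}$. For each non-negative integer $i$ let $$W_i=\{w\in W\mid \deg_G(w)=i\},\qquad W'_i=\{w'\in W'\mid \deg_{G'}(w')=i\}.$$ Then $(U,\tau)$ and $(U',\tau')$ are homeomorphic if and only if $|W_i|=|W'_i|$ for every non-negative integer $i$.
   Context: For a finite set $W$, $P(W)$ denotes the set of all subsets of $W$ and $P^{\star}(W)$ the set of all non-empty subsets of $W$; $X^c=W\setminus X$ for $X\subseteq W$. An $S_{\mathcal{MC}}$-approximation is a quadruple $G=(U,W,T,S)$ where $U$ and $W$ are finite non-empty sets, $T:U\to P^{\star}(W)$ and $S:P(W)\times P(W)\to\{0,1\}$ are maps such that: (i) ($S$-min condition) $S(A,B\cap C)=\min\{S(A,B),S(A,C)\}$ for all non-empty $A,B,C\subseteq W$; (ii) (complement condition) $S(A,B^c)=1-S(A,B)$ for all $A,B\subseteq W$; (iii) $S(A,\emptyset)=0$ for all $A\subseteq W$. For $X\subseteq W$, the upper approximation of $X$ is $\overline{G}(X)=\{x\in U\mid S(T(x),X^c)=0\}$. The family $\{\overline{G}(A)\mid A\subseteq W\}$ is a topology on $U$. For $A\subseteq W$ let $f_A:P(W)\to\{0,1\}$, $f_A(B)=S(A,B)$. An atom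 of a function $f:P(W)\to\{0,1\}$ is a non-empty $\omega\subseteq W$ with $f(\omega)=1$ and $f(\eta)=0$ for every non-empty proper subset $\eta$ of $\omega$. When $f$ has a single atom it is denoted $\alpha(f)$; so $\alpha(f)=\{w\}$ means that $\{w\}$ is the unique atom of $f$. The degree of $w\in W$ is $\deg_G(w)=|\{u\in U\mid \alpha(f_{T(u)})=\{w\}\}|$. The corresponding notions for $G'$ are defined in the same way. *)

(* Defs.v *)
From HB Require Import structures.
From mathcomp Require Import boolp classical_sets topology.
From mathcomp Require Import all_boot.

Set Implicit Arguments.
Unset Strict Implicit.
Unset Printing Implicit Defensive.

Local Open Scope set_scope.

(* Values in {0,1} are encoded as booleans: minimum is &&, 1 - x is ~~ x. *)
Record smc_approx (U W : finType) := SmcApprox {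
  smc_T : U -> {set W};
  smc_S : {set W} -> {set W} -> bool;
  smc_U_nonempty : (0 < #|U|)%N;
  smc_W_nonempty : (0 < #|W|)%N;
  smc_T_nonempty : forall u : U, smc_T u != set0;
  smc_S_min : forall A B C : {set W},
    A != set0 -> B != set0 -> C != set0 ->
    smc_S A (B :&: C) = smc_S A B && smc_S A C;
  smc_S_compl : forall A B : {set W}, smc_S A (~: B) = ~~ smc_S A B;
  smc_S_set0 : forall A : {set W}, smc_S A set0 = false
}.

Definition upper (U W : finType) (G : smc_approx U W) (X : {set W}) : {set U} :=
  [set x | smc_S G (smc_T G x) (~: X) == false].

Definition is_atom (W : finType) (f : {set W} -> bool) (omega : {set W}) : bool :=
  [&& omega != set0, f omega &
      [forall eta : {set W}, (eta != set0) && (eta \proper omega) ==> ~~ f eta]].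

(* alpha(f) = omega, i.e., omega is the single atom of f. *)
Definition unique_atom (W : finType) (f : {set W} -> bool) (omega : {set W}) : bool :=
  [set eta | is_atom f eta] == [set omega].

Definition degree (U W : finType) (G : smc_approx U W) (w : W) : nat :=
  #|[set u | unique_atom (smc_S G (smc_T G u)) [set w]]|.

Definition degree_class (U W : finType) (G : smc_approx U W) (i : nat) : {set W} :=
  [set w | degree G w == i].

(* Alias of U carrying the topology whose open sets are the upper approximations. *)
Definition approx_space (U W : finType) (G : smc_approx U W) : Type := U.

Definition upper_family (U W : finType) (G : smc_approx U W) :
    set (set (approx_space G)) :=
  [set O | exists A : {set W}, O = [set` upper G A]]%classic.

Arguments upper_family {U W} G _.

Section UpperTopology.
Variables (U W : finType) (G : smc_approx U W).

Lemma in_upper (X : {set W}) (x : U) : (x \in upper G X) = smc_S G (smc_T G x) X.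
Proof. by rewrite inE smc_S_compl; case: smc_S. Qed.

Lemma upper0 : upper G set0 = set0.
Proof. by apply/setP => x; rewrite in_upper smc_S_set0 in_set0. Qed.

Lemma upperT : upper G setT = setT.
Proof. by apply/setP => x; rewrite in_upper in_setT -setC0 smc_S_compl smc_S_set0. Qed.

Lemma upperC (X : {set W}) : upper G (~: X) = ~: upper G X.
Proof. by apply/setP => x; rewrite in_setC !in_upper smc_S_compl. Qed.

Lemma upperI (X Y : {set W}) : upper G (X :&: Y) = upper G X :&: upper G Y.
Proof.
have [->|X0] := eqVneq X set0; first by rewrite set0I upper0 set0I.
have [->|Y0] := eqVneq Y set0; first by rewrite setI0 upper0 setI0.
apply/setP => x; rewrite in_setI !in_upper smc_S_min //.
exact: smc_T_nonempty.
Qed.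

Lemma upperU (X Y : {set W}) : upper G (X :|: Y) = upper G X :|: upper G Y.
Proof. by apply: setC_inj; rewrite setCU -!upperC -upperI setCU. Qed.

Lemma upper_familyT : upper_family G classical_sets.setT.
Proof. by exists setT; apply/funext => x /=; rewrite upperT in_setT; apply/propext. Qed.

Lemma upper_familyI : setI_closed (upper_family G).
Proof.
move=> _ _ [A ->] [B ->]; exists (A :&: B); apply/funext => x /=.
by rewrite upperI in_setI; apply/propext; split=> /andP.
Qed.

Lemma upper_family_bigU (I : Type) (F : I -> set (approx_space G)) :
  (forall i, upper_family G (F i)) ->
  upper_family G (classical_sets.bigcup classical_sets.setT F).
Proof.
move=> FG; set V := classical_sets.bigcup _ _.
pose Q := [pred A : {set W} | `[< forall x, x \in upper G A -> V x >]].
exists (\bigcup_(A | Q A) A); apply/funext => x /=; apply/propext.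
rewrite (big_morph (upper G) upperU upper0); split.
  case=> i _ Fix; have [A FA] := FG i; apply/bigcupP; exists A.
    by apply/asboolP => y yA; exists i => //; rewrite FA.
  by move: Fix; rewrite FA.
by case/bigcupP => A /asboolP; apply.
Qed.

HB.instance Definition _ := Choice.copy (approx_space G) U.
HB.instance Definition _ := isOpenTopological.Build (approx_space G)
  upper_familyT upper_familyI upper_family_bigU.

Lemma open_upperE : (@open (approx_space G)) = upper_family G.
Proof. by []. Qed.

End UpperTopology.

Definition homeomorphic (X Y : topologicalType) : Prop :=
  exists (f : X -> Y) (g : Y -> X),
    [/\ cancel f g, cancel g f, continuous f & continuous g].

(* Main.v *)
Require Import Defs.
From mathcomp Require Import boolp classical_sets.
From mathcomp Require Import all_boot.
From mathcomp Require Import topology.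

(** Each [f_A] with [A] non-empty is the indicator of an ultrafilter on [W]:
    the complement condition makes it choose one of [B] and [~: B], and the
    minimum condition makes it closed under intersection.  As [W] is finite this
    ultrafilter is principal, so every point [u] of [U] has a pole [w] in [W]
    with [f_(T u) B = (w \in B)] (lemma [smc_S_principal]).  Hence the open sets
    are the preimages of subsets of [W] under the map [pole], that is, the
    unions of its fibres, and the degree of [w] is the size of the fibre of [w].

    So a map is continuous exactly when it sends fibres into fibres
    ([continuous_poleP]), and a homeomorphism is a bijection that carries the
    partition of [U] into fibres to that of [U'].  Such a bijection exists if and
    only if both partitions have the same number of blocks of each size.
    Blocks of size [i > 0] are the elements of degree [i]; the elements of
    degree [0] are what remains of [W], and so their number is determined
    by [#|W|].

    For the forward direction the numbers are compared by double counting: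
    exactly [#|degree_class G i| * i] points of [U] lie in a fibre of size [i],
    and a homeomorphism preserves that number.  For the converse, one lemma is
    used twice ([fibrewise_bijection]: maps to a common set whose fibres are
    equinumerous differ by a bijection of their domains), first to match [W] with
    [W'] over the degrees, then to match [U] with [U'] over the poles. *)

Set Implicit Arguments.
Unset Strict Implicit.
Unset Printing Implicit Defensive.

(** * Fibres of maps between finite sets *)

(** In each fibre, the element at a given position of the enumeration of the
    first fibre is matched with the one at the same position in the second.  This
    relation is the graph of a bijection. *)
Lemma fibrewise_bijection (X Y : finType) (K : eqType) (p : X -> K) (q : Y -> K) :
  (forall k, #|[set x | p x == k]| = #|[set y | q y == k]|) ->
  exists (h : X -> Y) (g : Y -> X),
    [/\ cancel h g, cancel g h & forall x, q (h x) = p x].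
Proof.
move=> pq_card.
pose A k := enum [set x | p x == k]; pose B k := enum [set y | q y == k].
have sAB k : size (A k) = size (B k) by rewrite -!cardE pq_card.
have xA x : x \in A (p x) by rewrite mem_enum inE.
have yB y : y \in B (q y) by rewrite mem_enum inE.
pose R x y := q y = p x /\ index x (A (p x)) = index y (B (p x)).
have Rl x : exists y, R x y.
  have ltx : index x (A (p x)) < size (B (p x)) by rewrite -sAB index_mem.
  case defB: (B (p x)) ltx => [//|y0 s]; rewrite -defB => ltx.
  exists (nth y0 (B (p x)) (index x (A (p x)))); split.
    by have := mem_nth y0 ltx; rewrite mem_enum inE => /eqP.
  by rewrite index_uniq ?enum_uniq.
have Rr y : exists x, R x y.
  have lty : index y (B (q y)) < size (A (q y)) by rewrite sAB index_mem.
  case defA: (A (q y)) lty => [//|x0 s]; rewrite -defA => lty.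
  exists (nth x0 (A (q y)) (index y (B (q y)))).
  have px : p (nth x0 (A (q y)) (index y (B (q y)))) = q y.
    by have := mem_nth x0 lty; rewrite mem_enum inE => /eqP.
  by split; rewrite px ?index_uniq ?enum_uniq.
have [h hR] := choice Rl; have [g gR] := choice Rr.
exists h, g; split=> [x|y|x]; last by case: (hR x).
- have [e1 i1] := gR (h x); have [e2 i2] := hR x.
  move: i1; rewrite -e1 e2 -i2; apply: (index_inj x); last exact: xA.
  by rewrite -e2 e1.
- have [e1 i1] := gR y; have [e2 i2] := hR (g y).
  move: i1; rewrite i2 -e2; apply: (index_inj y); first exact: yB.
  by rewrite e2 -e1.
Qed.

(** Both sides count the points of [X] that lie in a fibre of size [i]. *)
Lemma card_fibres_of_size (X Y : finType) (p : X -> Y) (i : nat) :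
  #|[set x | #|[set z | p z == p x]| == i]|
  = #|[set y | #|[set z | p z == y]| == i]| * i.
Proof.
pose D := [set y | #|[set z | p z == y]| == i]; rewrite -sum1_card.
rewrite (partition_big p [in D]) => [|x]; last by rewrite !inE.
rewrite -/D -sum_nat_const; apply: eq_bigr => y; rewrite inE => /eqP <-.
rewrite sum1dep_card; apply: eq_card => x; rewrite !inE.
by have [<-|] := eqVneq (p x) y; rewrite ?andbF // eqxx.
Qed.

(** * Poles and degrees *)

Section Pole.
Variables (U W : finType) (G : smc_approx U W).

(** An ultrafilter on a finite set is principal: [W] is the union of its
    singletons, and since [upper G] commutes with unions, one of them has
    value [1]. *)
Lemma smc_S_principal (u : U) :
  exists w, forall B, smc_S G (smc_T G u) B = (w \in B).
Proof.
have: u \in upper G setT by rewrite upperT inE.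
rewrite -(eqP (_ : \bigcup_(w : W) [set w] == setT)); last first.
  by apply/eqP/setP => w; rewrite inE; apply/bigcupP; exists w; rewrite ?inE.
rewrite (big_morph _ (upperU G) (upper0 G)) => /bigcupP[w _ uw].
exists w => B; rewrite -in_upper.
have [wB|wB] := boolP (w \in B).
  move: uw; rewrite -(setIidPl (_ : [set w] \subset B)) ?sub1set //.
  by rewrite upperI inE => /andP[].
apply/negbTE/negP => uB.
have: u \in upper G ([set w] :&: B) by rewrite upperI inE uw.
suff -> : [set w] :&: B = set0 by rewrite upper0 inE.
by apply/setP => v; rewrite !inE; apply/andP=> -[/eqP->]; apply/negP.
Qed.

Definition pole (u : U) : W := sval (cid (smc_S_principal u)).

Lemma smc_S_pole (u : U) B : smc_S G (smc_T G u) B = (pole u \in B).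
Proof. by rewrite /pole; case: cid. Qed.

Lemma upper_pole (A : {set W}) (u : U) : (u \in upper G A) = (pole u \in A).
Proof. by rewrite in_upper smc_S_pole. Qed.

Lemma unique_atom_pole (u : U) (w : W) :
  unique_atom (smc_S G (smc_T G u)) [set w] = (pole u == w).
Proof.
suff atomE : [set eta | is_atom (smc_S G (smc_T G u)) eta] = [set [set pole u]].
  by rewrite /unique_atom atomE !(inj_eq set1_inj).
apply/setP => eta; rewrite !inE /is_atom smc_S_pole.
apply/and3P/eqP => [[_ peta /forallP min_eta]|->].
  apply/eqP; rewrite eq_sym eqEproper sub1set peta /=; apply/negP => lt_eta.
  have /implyP := min_eta [set pole u].
  by rewrite lt_eta andbT smc_S_pole set11 -card_gt0 cards1 => /(_ isT).
split; rewrite ?set11 -?card_gt0 ?cards1 //.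
apply/forallP => B; apply/implyP => /andP[B0]; rewrite properEneq => /andP[neB].
by rewrite subset1 (negbTE neB) (negbTE B0).
Qed.

Lemma degree_pole (w : W) : degree G w = #|[set u | pole u == w]|.
Proof. by apply: eq_card => u; rewrite !inE unique_atom_pole. Qed.

Lemma card_degree_mem (i : nat) :
  #|[set u | degree G (pole u) == i]| = #|degree_class G i| * i.
Proof.
have := card_fibres_of_size pole i.
by congr (_ = _ * i); apply: eq_card => u; rewrite !inE degree_pole.
Qed.

Lemma sum_degree_class : \sum_(i < #|U|.+1) #|degree_class G i| = #|W|.
Proof.
have deg_lt w : degree G w < #|U|.+1 by rewrite ltnS max_card.
rewrite -[RHS]sum1_card.
rewrite [RHS](partition_big (fun w => Ordinal (deg_lt w)) xpredT) //=.
by apply: eq_bigr => i _; rewrite sum1dep_card; apply: eq_card => w; rewrite !inE.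
Qed.

End Pole.

(** * Homeomorphisms *)

(** The fibres of [pole] are the smallest non-empty open sets: the preimage of
    the fibre of [h u] is open, so it contains the fibre of [u]. *)
Lemma continuous_poleP (U W U' W' : finType) (G : smc_approx U W)
    (G' : smc_approx U' W') (h : approx_space G -> approx_space G') :
  continuous h <->
  forall u v, pole G u = pole G v -> pole G' (h u) = pole G' (h v).
Proof.
split=> [/continuousP ch u v uv|hpole].
  pose O := [set` upper G' [set pole G' (h u)]]%classic.
  have [A hA] : upper_family G (h @^-1` O)%classic.
    by apply: ch; exists [set pole G' (h u)].
  have inA x : (pole G' (h x) == pole G' (h u)) = (pole G x \in A).
    have /(congr1 (fun P => P x)) /= := hA.
    by rewrite /O /= !upper_pole inE => e; apply/idP/idP; rewrite e.
  by apply/esym/eqP; rewrite inA -uv -inA.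
apply/continuousP => _ [A ->].
exists [set pole G u | u in [set u : U | pole G' (h u) \in A]].
apply/funext => u /=; rewrite !upper_pole; apply/propext; split.
  by move=> huA; apply/imsetP; exists u; rewrite ?inE.
by case/imsetP => v; rewrite inE => hvA /hpole ->.
Qed.

Lemma homeomorphic_poleP (U W U' W' : finType)
    (G : smc_approx U W) (G' : smc_approx U' W') :
  homeomorphic (approx_space G) (approx_space G') <->
  exists (f : U -> U') (g : U' -> U), [/\ cancel f g, cancel g f &
    forall u v, (pole G' (f u) == pole G' (f v)) = (pole G u == pole G v)].
Proof.
split=> -[f [g]].
  case=> fK gK /continuous_poleP cf /continuous_poleP cg.
  exists f, g; split=> // u v; apply/eqP/eqP => [/cg|/cf //].
  by rewrite !fK.
case=> fK gK fpole; exists f, g; split=> //; apply/continuous_poleP => u v /eqP.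
  by rewrite -fpole => /eqP.
by move=> uv; apply/eqP; rewrite -fpole !gK.
Qed.

Theorem theorem5p5 (U W U' W' : finType)
    (G : smc_approx U W) (G' : smc_approx U' W')
    (card_U : #|U| = #|U'|) (card_W : #|W| = #|W'|) :
  homeomorphic (approx_space G) (approx_space G') <->
  (forall i : nat, #|degree_class G i| = #|degree_class G' i|).
Proof.
split=> [/homeomorphic_poleP[f [g [fK gK fpole]]] | eq_class].
  have degf u : degree G' (pole G' (f u)) = degree G (pole G u).
    rewrite !degree_pole -(card_imset _ (can_inj fK)).
    apply: eq_card => v; rewrite -[v]gK (mem_imset _ _ (can_inj fK)) !inE.
    by rewrite fpole.
  have eq_class_pos i : 0 < i -> #|degree_class G i| = #|degree_class G' i|.
    move=> i_gt0; apply/eqP; rewrite -(eqn_pmul2r i_gt0) -!card_degree_mem.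
    rewrite -(card_imset _ (can_inj fK)); apply/eqP/eq_card => v.
    by rewrite -[v]gK (mem_imset _ _ (can_inj fK)) !inE degf.
  (* Degree [0] escapes the double count; it is settled by [card_W]. *)
  case=> [|i]; last exact: eq_class_pos.
  have := sum_degree_class G; rewrite card_W -(sum_degree_class G') card_U.
  rewrite !big_ord_recl /= => /eqP.
  rewrite (eq_bigr (fun i : 'I_#|U'| => #|degree_class G' (lift ord0 i)|)).
    by rewrite eqn_add2r => /eqP.
  by move=> i _; apply: eq_class_pos.
have [s [t [sK tK degs]]] := fibrewise_bijection eq_class.
have [|f [g [fK gK fpole]]] :=
    @fibrewise_bijection U U' W' (fun u => s (pole G u)) (pole G').
  move=> w; rewrite -degree_pole -[w]tK degs degree_pole.
  by apply: eq_card => u; rewrite !inE (can_eq sK).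
apply/homeomorphic_poleP; exists f, g; split=> // u v.
by rewrite !fpole (can_eq sK).
Qed.
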